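(* Consider the (static) lowest unique bid auction game with an arbitrary number $n$ of bidders, object value $v$ and bidding cost $c>0$. In every Nash equilibrium (in mixed strategies) of the game among the bidders, the expected payoff to the seller is non-positive.
   Context: The lowest unique bid auction game: there is an object of common value $v>0$ (a real number), a bidding cost $c>0$ (a real number), and a set of bidders $\mathcal{B}=\{1,\dots,n\}$. Here $\mathbb{N}$ denotes the positive integers. Simultaneously and independently, each bidder $i$ submits a finite (possibly empty) set $S_i\subset\mathbb{N}$ of bids. Let $S_*=\{s\in\mathbb{N}: \#\{i\in\mathcal{B}: s\in S_i\}=1\}$ be the set of integers bid by exactly one bidder. If $S_*=\varnothing$ there is no winner. If $S_*\neq\varnothing$, the winning bid is $s_*=\min(S_* )$ and the winner $i_*$ is the unique bidder with $s_*\in S_{i_*}$. The payoff of bidder $i$ is $u_i(S_1,\dots,S_n)=-c|S_i|+v-s_*$ if $i$ is the winner, and $u_i(S_1,\dots,S_n)=-c|S_i|$ otherwise. The payoff to the seller is $u_S=\sum_{i=1}^n c|S_i|+s_*-v$ if there is a winner, and $u_S=\sum_{i=1}^n c|S_i|$ if there is no winner; thus $u_S=-\sum_{i=1}^n u_i$. The seller makes no strategic choice. A pure strategy of a bidder is a finite subset of $\mathbb{N}$; a mixed strategy is a probability distribution over pure strategies. Bidders maximize expected payoff, and ''equilibrium'' means Nash equilibrium in mixed strategies. *)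

(* Defs.v *)
From mathcomp Require Import all_boot all_order all_algebra finmap.
From mathcomp Require Import all_classical all_reals all_analysis.

Set Implicit Arguments.
Unset Strict Implicit.
Unset Printing Implicit Defensive.

Import Order.TTheory GRing.Theory Num.Theory.

Local Open Scope classical_set_scope.
Local Open Scope fset_scope.
Local Open Scope ring_scope.

(* Bids are positive integers. *)
Definition pure_strategy := {S : {fset nat} | 0%N \notin S}.

Definition profile (n : nat) := {ffun 'I_n -> pure_strategy}.

Section Game.
Variables (R : realType) (n : nat).

Definition unique_bids (S : profile n) : {fset nat} :=
  [fset s in (\bigcup_(i <- enum 'I_n) val (S i))%fset
    | #|[set i : 'I_n | s \in val (S i)]%SET| == 1%N].

(* [Some] of the least element of [unique_bids S], if there is one; the winner
   is then the only bidder whose set contains it. *)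
Definition winning_bid (S : profile n) : option nat :=
  ohead (sort leq (unique_bids S)).

Definition payoff (v c : R) (i : 'I_n) (S : profile n) : R :=
  if winning_bid S is Some s then
    if s \in val (S i) then - (c * #|` val (S i)|%:R) + v - s%:R
    else - (c * #|` val (S i)|%:R)
  else - (c * #|` val (S i)|%:R).

Definition seller_payoff (v c : R) (S : profile n) : R :=
  if winning_bid S is Some s then
    (\sum_(i < n) c * #|` val (S i)|%:R) + s%:R - v
  else \sum_(i < n) c * #|` val (S i)|%:R.

(* There are countably many pure strategies, so that a probability distribution
   over them is given by its mass function; its support may be infinite. *)
Record mixed_strategy := MixedStrategy {
  mass :> pure_strategy -> R;
  mass_ge0 : forall S, 0 <= mass S;
  mass_sum1 : \esum_(S in [set: pure_strategy]) (mass S)%:E = 1%E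
}.

(* Bidders randomize independently. *)
Definition profile_mass (sigma : 'I_n -> mixed_strategy) (S : profile n) : R :=
  \prod_(i < n) sigma i (S i).

(* [\esum] is meant for nonnegative families, hence the splitting into positive
   and negative parts. The payoffs of the bidders are bounded above and that of
   the seller is bounded below, so +oo - +oo never occurs for them; expected
   payoffs can nevertheless be infinite. *)
Definition expected_payoff (sigma : 'I_n -> mixed_strategy)
    (f : profile n -> R) : \bar R :=
  let g := fun S => (profile_mass sigma S * f S)%:E in
  (\esum_(S in [set: profile n]) g^\+ S - \esum_(S in [set: profile n]) g^\- S)%E.

Definition deviate (sigma : 'I_n -> mixed_strategy) (i : 'I_n)
    (tau : mixed_strategy) : 'I_n -> mixed_strategy :=
  fun j => if j == i then tau else sigma j.

Definition nash_equilibrium (v c : R) (sigma : 'I_n -> mixed_strategy) : Prop :=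
  forall (i : 'I_n) (tau : mixed_strategy),
    (expected_payoff (deviate sigma i tau) (payoff v c i)
       <= expected_payoff sigma (payoff v c i))%E.

End Game.

(* Main.v *)
(* Bidding nothing yields 0 against anything, so every bidder's expected payoff
   is nonnegative in equilibrium, and the seller's payoff is minus the sum of the
   bidders' payoffs. As the support may be infinite, expectations are additive
   only after checking finiteness: a bidder never gains more than v, so the
   positive part of her payoff has finite expectation. *)

Require Import Defs.
From mathcomp Require Import all_boot all_order all_algebra finmap.
From mathcomp Require Import all_classical all_reals all_analysis.

Import Order.TTheory GRing.Theory Num.Theory.

Local Open Scope classical_set_scope.
Local Open Scope ring_scope.

(** Finitely many functions take finitely many values, so they lie in a finite box. Over a box, the
    sum of products factors into a product of sums, each at most 1. *)
Lemma esum_ffun_prod_le1 (R : realType) (I : finType) (T : choiceType)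
    (m : I -> T -> R) :
  (forall i x, 0 <= m i x) ->
  (forall i, (\esum_(x in [set: T]) (m i x)%:E <= 1)%E) ->
  (\esum_(f in [set: {ffun I -> T}]) (\prod_i m i (f i))%:E <= 1)%E.
Proof.
move=> m_ge0 m_le1.
apply: ge_ereal_sup => _ [F [finF _] <-].
rewrite fsbig_finite //= sumEFin lee_fin.
(* [s] lists all values taken by members of [F]. The finite type [seq_sub s] is the side of the box,
   and [g] below embeds the box into the functions to [T]. *)
pose s := [seq (f : {ffun I -> T}) i | f <- enum_fset (fset_set F), i <- enum I].
have s_val (f : {ffun I -> T}) i : f \in fset_set F -> f i \in s.
  by move=> fF; apply/allpairsP; exists (f, i); rewrite mem_enum.
have m_s i : \sum_(x : seq_sub s) m i (val x) <= 1.
  rewrite -lee_fin -sumEFin; apply: le_trans (m_le1 i).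
  apply: esum_ge; exists [set` codom (val : seq_sub s -> T)].
    by split => //; exact: finite_seq.
  rewrite -fsbig_seq; first by rewrite big_image.
  by rewrite map_inj_uniq ?enum_uniq //; exact: val_inj.
pose g (f : {ffun I -> seq_sub s}) : {ffun I -> T} := [ffun i => val (f i)].
have g_inj : injective g.
  by move=> f h /ffunP fh; apply/ffunP => i; have := fh i; rewrite !ffunE => /val_inj.
have F_g : perm_eq (enum_fset (fset_set F)) [seq f <- codom g | f \in fset_set F].
  apply: uniq_perm; first exact: fset_uniq.
    by rewrite filter_uniq // map_inj_uniq // enum_uniq.
  move=> f.
  rewrite mem_filter; apply/idP/andP => [fF|[//]].
  split=> //; apply/codomP; exists [ffun i => SeqSub (s_val f i fF)].
  by apply/ffunP => i; rewrite !ffunE.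
(* Enlarging [F] to the whole box only adds nonnegative terms and makes distributivity
   applicable. *)
apply: (@le_trans _ _ (\sum_(f <- codom g) \prod_i m i (f i))).
  rewrite (perm_big _ F_g) /= big_filter big_mkcond /=.
  by apply: ler_sum => f _; case: ifP => // _; exact: prodr_ge0.
rewrite big_image /=.
under eq_bigr do under eq_bigr do rewrite ffunE.
rewrite -(bigA_distr_bigA (fun i (x : seq_sub s) => m i (val x))).
apply: prodr_ile1 => i _; rewrite m_s andbT.
by apply: sumr_ge0 => x _; exact: m_ge0.
Qed.

Lemma expected_payoff_eq0 (R : realType) (n : nat)
    (sigma : 'I_n -> mixed_strategy R) (f : profile n -> R) :
  (forall S, profile_mass sigma S * f S = 0) -> expected_payoff sigma f = 0%E.
Proof.
move=> f0; rewrite /expected_payoff.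
by rewrite !esum1 ?sube0 // => S _; rewrite ?funeposE ?funenegE f0 ?oppe0 maxxx.
Qed.

Lemma profile_mass_ge0 (R : realType) (n : nat)
    (sigma : 'I_n -> mixed_strategy R) (S : profile n) :
  0 <= profile_mass sigma S.
Proof. by apply: prodr_ge0 => i _; exact: mass_ge0. Qed.

Lemma payoff_le (R : realType) (n : nat) (v c : R) (i : 'I_n) (S : profile n) :
  0 <= v -> 0 <= c -> payoff v c i S <= v.
Proof.
move=> v_ge0 c_ge0; have cS_ge0 : 0 <= c * #|` val (S i)|%:R by rewrite mulr_ge0.
have loss_le : - (c * #|` val (S i)|%:R) <= v by rewrite (le_trans _ v_ge0) ?oppr_le0.
rewrite /payoff; case: winning_bid => // s; case: ifP => // _.
by rewrite lerBlDr addrC lerD // (le_trans _ (ler0n _ s)) ?oppr_le0.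
Qed.

(** Costs match bidder by bidder. The winning bid lies in exactly one bidder's set, so [v - s] is
    counted once in the sum. *)
Lemma seller_payoffE (R : realType) (n : nat) (v c : R) (S : profile n) :
  seller_payoff v c S = - \sum_(i < n) payoff v c i S.
Proof.
rewrite /seller_payoff /payoff.
case W : winning_bid => [s|]; last by rewrite sumrN opprK.
have sU : s \in unique_bids S.
  rewrite -(mem_sort leq); move: W; rewrite /winning_bid.
  by case: sort => // x t [->]; rewrite mem_head.
have /eqP s1 : #|[set i : 'I_n | s \in val (S i)]%SET| == 1%N.
  by move: sU; rewrite !inE => /andP[].
rewrite [in RHS](eq_bigr (fun i => - (c * #|` val (S i)|%:R)
    + (if s \in val (S i) then v - s%:R else 0))); last first.
  by move=> i _; case: ifP => _; rewrite ?addr0 ?addrA.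
rewrite big_split /= sumrN -big_mkcond /= sumr_const.
by rewrite -cardsE s1 mulr1n opprD opprK opprB addrA.
Qed.

Lemma esum_funepos_payoff_fin_num (R : realType) (n : nat) (v c : R)
    (sigma : 'I_n -> mixed_strategy R) (i : 'I_n) :
  0 <= v -> 0 <= c ->
  (\esum_(S in [set: profile n])
     (fun S => (profile_mass sigma S * payoff v c i S)%:E)^\+%E S)
    \is a fin_num.
Proof.
move=> v_ge0 c_ge0; rewrite ge0_fin_numE; last first.
  by apply: esum_ge0 => S _; exact: funepos_ge0.
apply: (@le_lt_trans _ _ v%:E); last exact: ltry.
apply: ge_ereal_sup => _ [F [finF _] <-].
(* Each positive part is at most mass times [v], and the masses over [F] sum to at most 1 by
   [esum_ffun_prod_le1]. *)
apply: (@le_trans _ _ (\sum_(S <- fset_set F) (profile_mass sigma S)%:E * v%:E)%E).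
  rewrite fsbig_finite //; apply: lee_sum => S _.
  rewrite funeposE -EFinM ge_max !lee_fin mulr_ge0 ?profile_mass_ge0 // andbT.
  by rewrite ler_wpM2l ?profile_mass_ge0 ?payoff_le.
under eq_bigr do rewrite -EFinM.
rewrite sumEFin -mulr_suml lee_fin ler_piMl // -lee_fin -sumEFin -fsbig_finite //.
apply: le_trans (esum_ffun_prod_le1 _ _ _ (fun j => mass (sigma j)) _ _).
- by apply: esum_ge; exists F.
- by move=> j S; exact: mass_ge0.
- by move=> j; rewrite mass_sum1.
Qed.

Lemma esum_point_mass (R : realType) (T : choiceType) (x0 : T) :
  \esum_(x in [set: T]) ((x == x0)%:R : R)%:E = 1%E.
Proof.
rewrite (esumID [set x0]); last by move=> x _; rewrite lee_fin.
rewrite setTI setTI esum_set1 ?eqxx ?lee_fin // esum1 ?adde0 // => x /= /eqP.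
by move=> /negbTE ->.
Qed.

Definition point_mass (R : realType) (S0 : pure_strategy) : mixed_strategy R :=
  MixedStrategy (fun S => ler0n R (S == S0)) (esum_point_mass R _ S0).

Definition no_bid : pure_strategy := exist _ fset0 (negbT (in_fset0 0%N)).

Lemma payoff_no_bid (R : realType) (n : nat) (v c : R) (i : 'I_n)
    (S : profile n) :
  S i = no_bid -> payoff v c i S = 0.
Proof.
move=> Si; rewrite /payoff Si (cardfs0 _ : #|` val no_bid| = 0%N) mulr0 oppr0.
by case: (winning_bid S) => // s; rewrite in_fset0.
Qed.

Lemma nash_expected_payoff_ge0 (R : realType) (n : nat) (v c : R)
    (sigma : 'I_n -> mixed_strategy R) (i : 'I_n) :
  nash_equilibrium v c sigma -> (0 <= expected_payoff sigma (payoff v c i))%E.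
Proof.
move=> /(_ i (point_mass R no_bid)); rewrite expected_payoff_eq0 // => S.
(* After the deviation to [no_bid], a profile in which [i] bids has mass 0, since the factor of the
   point mass vanishes; in any other profile her payoff is 0. *)
have [/payoff_no_bid ->|Si] := eqVneq (S i) no_bid; first by rewrite mulr0.
by rewrite /profile_mass (bigD1 i) //= /deviate eqxx /= (negbTE Si) !mul0r.
Qed.

Theorem theorem3p4 (R : realType) (n : nat) (v c : R)
    (v_gt0 : 0 < v) (c_gt0 : 0 < c) (sigma : 'I_n -> mixed_strategy R)
    (sigma_nash : nash_equilibrium v c sigma) :
  (expected_payoff sigma (seller_payoff v c) <= 0)%E.
Proof.
rewrite /expected_payoff /= sube_le0.
set g := fun S => (profile_mass sigma S * seller_payoff v c S)%:E.
pose u i (S : profile n) := (profile_mass sigma S * payoff v c i S)%:E.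
pose A i := \esum_(S in [set: profile n]) (u i)^\+%E S.
pose B i := \esum_(S in [set: profile n]) (u i)^\-%E S.
have A_fin i : A i \is a fin_num by exact: esum_funepos_payoff_fin_num (ltW _) (ltW _).
have B_le_A i : (B i <= A i)%E.
  by rewrite -sube_ge0 ?A_fin ?orbT //; exact: nash_expected_payoff_ge0.
(* This is the pointwise identity [g = - sum of u i], rearranged so that both sides are sums of
   nonnegative terms. It can then be summed over all profiles even when some totals are infinite. *)
have balance S : (g^\+ S + \sum_(i < n) (u i)^\+ S = g^\- S + \sum_(i < n) (u i)^\- S)%E.
  have split_pn (x : R) : Num.max x 0 = x + Num.max (- x) 0.
    by rewrite !maxEle !oppr_le0; case: ltgtP => [_|_|->]; rewrite ?subrr ?addr0.
  rewrite funeposE funenegE -EFin_max -EFinN.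
  under eq_bigr do rewrite funeposE -EFin_max split_pn.
  under [in RHS]eq_bigr do rewrite funenegE -EFinN -EFin_max.
  rewrite -EFin_max !sumEFin -!EFinD split_pn big_split /= seller_payoffE mulrN mulr_sumr.
  by congr EFin; rewrite addrACA addNr add0r.
have AB : (\esum_(S in [set: profile n]) g^\+%E S + \sum_(i < n) A i =
        \esum_(S in [set: profile n]) g^\-%E S + \sum_(i < n) B i)%E.
  rewrite -!esum_sum; try by move=> *; rewrite ?funepos_ge0 ?funeneg_ge0.
  rewrite -!esumD; try by move=> *; rewrite ?sume_ge0 ?funepos_ge0 ?funeneg_ge0.
  by apply: eq_esum => S _; exact: balance.
(* The total of the [A i] is finite, so it may be added to both sides of the goal. By [AB] the left
   side becomes the negative part of [g] plus the total of the [B i], and [B i <= A i] concludes. *)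
rewrite -(leeD2rE _ _ (_ : \sum_(i < n) A i \is a fin_num)%E); last first.
  by apply/sum_fin_numP.
by rewrite AB leeD2l // lee_sum.
Qed.
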